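(* Let $m,n\ge 1$ and let $\Phi^1\le\Gamma^1$, $\Phi^2\le\Gamma^2$ be integer-valued $m\times n$ matrices (entries of $\Phi^1,\Phi^2$ may be $-\infty$, entries of $\Gamma^1,\Gamma^2$ may be $+\infty$). Let $f\le g$ be integer-valued functions on $S_{m,n}$ ($f$ may take the value $-\infty$, $g$ the value $+\infty$), and let $\alpha\le\beta$ with $\alpha\in\mathbb{Z}\cup\{-\infty\}$, $\beta\in\mathbb{Z}\cup\{+\infty\}$. Then there exists a prefix-bounded matrix $x$ (with respect to $\Phi^1,\Gamma^1,\Phi^2,\Gamma^2$) such that $f(s)\le x(s)\le g(s)$ for all $s\in S_{m,n}$ and $\alpha\le\tilde x(S_{m,n})\le\beta$ if and only if, for every $X_1,X_2\subseteq S_{m,n}$, all of the following hold: $$p^*_1(X_1)+\tilde f(X_2-X_1)\le b^*_2(X_2)+\tilde g(X_1-X_2),$$ $$p^*_2(X_2)+\tilde f(X_1-X_2)\le b^*_1(X_1)+\tilde g(X_2-X_1),$$ $$b^*_1(X_1)+b^*_2(X_2)+\tilde g(\overline{X_1}\cap\overline{X_2})-\tilde f(X_1\cap X_2)\ge\alpha,$$ $$p^*_1(X_1)+p^*_2(X_2)+\tilde f(\overline{X_1}\cap\overline{X_2})-\tilde g(X_1\cap X_2)\le\beta.$$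
   Context: $S_{m,n}=[m]\times[n]$; an $m\times n$ matrix $x$ is viewed as a function on $S_{m,n}$, and for $Z\subseteq S_{m,n}$ and a function $h$ on $S_{m,n}$, $\tilde h(Z)=\sum_{s\in Z}h(s)$ (with $\tilde h(\emptyset)=0$); $\overline{Z}=S_{m,n}-Z$. For $(i,j)\in S_{m,n}$ let $P^1_{i,j}=\{(i,1),\dots,(i,j)\}$ (horizontal prefix) and $P^2_{i,j}=\{(1,j),\dots,(i,j)\}$ (vertical prefix). A prefix-bounded matrix with respect to $\Phi^1,\Gamma^1,\Phi^2,\Gamma^2$ is an integer-valued $m\times n$ matrix $x$ with $\Phi^1(i,j)\le\tilde x(P^1_{i,j})\le\Gamma^1(i,j)$ and $\Phi^2(i,j)\le\tilde x(P^2_{i,j})\le\Gamma^2(i,j)$ for all $(i,j)\in S_{m,n}$. A horizontal segment is a set $\{(i,j_1),(i,j_1+1),\dots,(i,j_2)\}$ with $1\le j_1\le j_2\le n$; a vertical segment is a set $\{(i_1,j),(i_1+1,j),\dots,(i_2,j)\}$ with $1\le i_1\le i_2\le m$. For $X\subseteq S_{m,n}$, $\mathcal I^{ho}(X)$ (resp. $\mathcal I^{ve}(X)$) is the set of inclusion-maximal horizontal (resp. vertical) segments contained in $X$. With the conventions $\Phi^1(i,0)=\Gamma^1(i,0)=0$ and $\Phi^2(0,j)=\Gamma^2(0,j)=0$, define for $X\subseteq S_{m,n}$: $p^*_1(X)=\sum[\Phi^1(i,j_2)-\Gamma^1(i,j_1-1):\{(i,j_1),\dots,(i,j_2)\}\in\mathcal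 I^{ho}(X)]$, $b^*_1(X)=\sum[\Gamma^1(i,j_2)-\Phi^1(i,j_1-1):\{(i,j_1),\dots,(i,j_2)\}\in\mathcal I^{ho}(X)]$, $p^*_2(X)=\sum[\Phi^2(i_2,j)-\Gamma^2(i_1-1,j):\{(i_1,j),\dots,(i_2,j)\}\in\mathcal I^{ve}(X)]$, $b^*_2(X)=\sum[\Gamma^2(i_2,j)-\Phi^2(i_1-1,j):\{(i_1,j),\dots,(i_2,j)\}\in\mathcal I^{ve}(X)]$ (empty sums are $0$). All expressions are evaluated in the extended integers with the usual conventions ($-\infty$ plus a finite number or $-\infty$ is $-\infty$, etc.); the inequalities never involve an undefined sum. *)

(* Defs.v *)
From HB Require Import structures.
From mathcomp Require Import all_boot all_order all_algebra.
From mathcomp Require Export constructive_ereal.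

Set Implicit Arguments.
Unset Strict Implicit.
Unset Printing Implicit Defensive.

Local Open Scope ereal_scope.

(* Extended integers are [\bar int].  Rows and columns are numbered from 0, so
   the pair (i, j) of [m] x [n] is represented by (i - 1, j - 1). *)

Section PrefixBounded.
Variables m n : nat.
Notation S := ('I_m * 'I_n)%type.
Implicit Types (i : 'I_m) (j : 'I_n) (X Z : {set S}) (M Phi Gam : 'M[\bar int]_(m, n)).

Definition tilde (h : S -> \bar int) Z : \bar int := \sum_(s in Z) h s.

Definition mxfun (x : 'M[int]_(m, n)) (s : S) : \bar int := (x s.1 s.2)%:E.

Definition prefix1 i j : {set S} := [set s : S | (s.1 == i) && (s.2 <= j)%N].
Definition prefix2 i j : {set S} := [set s : S | (s.2 == j) && (s.1 <= i)%N].

Definition prefix_bounded (Phi1 Gam1 Phi2 Gam2 : 'M[\bar int]_(m, n))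
    (x : 'M[int]_(m, n)) : Prop :=
  forall i j,
    (Phi1 i j <= tilde (mxfun x) (prefix1 i j) <= Gam1 i j) /\
    (Phi2 i j <= tilde (mxfun x) (prefix2 i j) <= Gam2 i j).

Definition hseg i j1 j2 : {set S} :=
  [set s : S | (s.1 == i) && (j1 <= s.2 <= j2)%N].
Definition vseg j i1 i2 : {set S} :=
  [set s : S | (s.2 == j) && (i1 <= s.1 <= i2)%N].

Definition is_hseg Z : bool :=
  [exists i : 'I_m, exists j1 : 'I_n, exists j2 : 'I_n,
    (j1 <= j2)%N && (Z == hseg i j1 j2)].
Definition is_vseg Z : bool :=
  [exists j : 'I_n, exists i1 : 'I_m, exists i2 : 'I_m,
    (i1 <= i2)%N && (Z == vseg j i1 i2)].

Definition Iho X : {set {set S}} :=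
  [set Z | maxset (fun Y => is_hseg Y && (Y \subset X)) Z].
Definition Ive X : {set {set S}} :=
  [set Z | maxset (fun Y => is_vseg Y && (Y \subset X)) Z].

(* The entry just before column j (resp. row i), with the convention that it is
   0 before the first one; [ord_pred] wraps around only at index 0. *)
Definition prev1 M i j : \bar int :=
  if (j == 0 :> nat)%N then 0 else M i (ord_pred j).
Definition prev2 M i j : \bar int :=
  if (i == 0 :> nat)%N then 0 else M (ord_pred i) j.

(* Sums over Iho X (resp. Ive X): each segment is [hseg i j1 j2] for exactly one
   triple (i, j1, j2) with j1 <= j2. *)
Definition pstar1 Phi Gam X : \bar int :=
  \sum_(i < m) \sum_(j1 < n) \sum_(j2 < n | (j1 <= j2)%N && (hseg i j1 j2 \in Iho X))
    (Phi i j2 - prev1 Gam i j1).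
Definition bstar1 Phi Gam X : \bar int :=
  \sum_(i < m) \sum_(j1 < n) \sum_(j2 < n | (j1 <= j2)%N && (hseg i j1 j2 \in Iho X))
    (Gam i j2 - prev1 Phi i j1).
Definition pstar2 Phi Gam X : \bar int :=
  \sum_(j < n) \sum_(i1 < m) \sum_(i2 < m | (i1 <= i2)%N && (vseg j i1 i2 \in Ive X))
    (Phi i2 j - prev2 Gam i1 j).
Definition bstar2 Phi Gam X : \bar int :=
  \sum_(j < n) \sum_(i1 < m) \sum_(i2 < m | (i1 <= i2)%N && (vseg j i1 i2 \in Ive X))
    (Gam i2 j - prev2 Phi i1 j).

End PrefixBounded.

(* Main.v *)
(** Row prefix sums, column prefix sums, entries and the total sum of a matrix
    form a circulation in a network with one node r(i,j) and one node c(i,j) per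
    cell, a source s and a sink t: the prefix sum of row i up to j flows from
    r(i,j+1) to r(i,j) (from s when j is last), the entry x(i,j) from r(i,j) to
    c(i,j), the prefix sum of column j up to i from c(i,j) to c(i+1,j) (to t when
    i is last), and the total from t to s.  By Hoffman's theorem an integral
    circulation within the bounds exists iff no cut Z is violated.  The maximal
    segments of X record exactly where a row or column enters and leaves X, and
    the four choices of which of s and t lie in Z give the four families of
    inequalities. *)

Require Import Defs.
From mathcomp Require Import all_boot all_order all_algebra.
From mathcomp Require Import zify ring.

Set Implicit Arguments.
Unset Strict Implicit.
Unset Printing Implicit Defensive.

Import Order.TTheory GRing.Theory Num.Theory.

Local Open Scope ring_scope.

(** * Extended integers *)

Lemma sum_neqNy (I : finType) (P : pred I) (h : I -> \bar int) :
  (forall i, h i != -oo%E) -> (\sum_(i | P i) h i)%E != -oo%E.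
Proof.
move=> h_fin; elim/big_rec: _ => // i a _.
by have := h_fin i; case: (h i) a => [b||] [a||].
Qed.

Lemma sum_neqy (I : finType) (P : pred I) (h : I -> \bar int) :
  (forall i, h i != +oo%E) -> (\sum_(i | P i) h i)%E != +oo%E.
Proof.
move=> h_fin; elim/big_rec: _ => // i a _.
by have := h_fin i; case: (h i) a => [b||] [a||].
Qed.

(** Excluding [+oo] matters: negation does not distribute over a sum of opposite infinities. *)
Lemma sum_oppe (I : finType) (P : pred I) (h : I -> \bar int) :
  (forall i, h i != +oo%E) -> (\sum_(i | P i) - h i = - \sum_(i | P i) h i)%E.
Proof.
move=> h_fin; apply: sumeN => s t _ _; rewrite /adde_def.
by rewrite (negbTE (h_fin s)) (negbTE (h_fin t)) andbF.
Qed.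

(** This and the next two lemmas turn a nonnegative cut slack into a stated inequality. No two
    opposite infinities meet on one side, so terms can be moved across. The trailing [0] stands for
    the total-sum arc, which does not cross the cut here. *)
Lemma slack_ge0_eq (p1 b2 f1 g1 : \bar int) :
    p1 != +oo%E -> b2 != -oo%E -> f1 != +oo%E -> g1 != -oo%E ->
  (0 <= - p1 + b2 + (g1 - f1 + 0))%E = (p1 + f1 <= b2 + g1)%E.
Proof.
case: p1 b2 f1 g1 => [p1||] [b2||] [f1||] [g1||] //= *;
  by rewrite ?leey ?leNye // !lee_fin; lia.
Qed.

Lemma alpha_slack_eq (a b1 b2 f1 g1 : \bar int) :
    a != +oo%E -> b1 != -oo%E -> b2 != -oo%E -> f1 != +oo%E -> g1 != -oo%E ->
  (0 <= b1 + b2 + (g1 - f1 - a))%E = (a <= b1 + b2 + g1 - f1)%E.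
Proof.
case: a b1 b2 f1 g1 => [a||] [b1||] [b2||] [f1||] [g1||] //= *;
  by rewrite ?leey ?leNye // !lee_fin; lia.
Qed.

Lemma beta_slack_eq (b p1 p2 f1 g1 : \bar int) :
    b != -oo%E -> p1 != +oo%E -> p2 != +oo%E -> f1 != +oo%E -> g1 != -oo%E ->
  (0 <= - p1 - p2 + (g1 - f1 + b))%E = (p1 + p2 + f1 - g1 <= b)%E.
Proof.
case: b p1 p2 f1 g1 => [b||] [p1||] [p2||] [f1||] [g1||] //= *;
  by rewrite ?leey ?leNye // !lee_fin; lia.
Qed.

(** * Hoffman's circulation theorem *)

(* Contribution to (upper bounds leaving Z) - (lower bounds entering Z) of an arc
   whose source is in Z iff a and whose target is in Z iff b. *)
Definition arc_slack (a b : bool) (lo up : \bar int) : \bar int :=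
  (if a then (if b then 0 else up) else (if b then - lo else 0))%E.

Lemma oppe_arc_slack a b lo up : (- arc_slack a b lo up = arc_slack b a up lo)%E.
Proof. by case: a b => [] [] /=; rewrite /arc_slack ?oppe0 ?oppeK. Qed.

Lemma arc_slackC a b lo up : arc_slack (~~ a) (~~ b) lo up = arc_slack b a lo up.
Proof. by case: a b => [] []. Qed.

Lemma arc_slack_neqNy a b lo up :
  lo != +oo%E -> up != -oo%E -> arc_slack a b lo up != -oo%E.
Proof. by case: a b lo up => [] [] [lo||] [up||]. Qed.

Lemma arc_slack_neqy a b lo up :
  lo != -oo%E -> up != +oo%E -> arc_slack a b lo up != +oo%E.
Proof. by case: a b lo up => [] [] [lo||] [up||]. Qed.

Section Circulation.
Variables (V E : finType) (src tgt : E -> V) (lo up : E -> \bar int).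
Implicit Types (y : E -> int) (v w : V) (Z : {set V}).

Definition feasible y := forall e, (lo e <= (y e)%:E <= up e)%E.

Definition excess y v : int :=
  \sum_e y e * ((tgt e == v)%:R - (src e == v)%:R).

Definition cut_slack Z : \bar int :=
  \sum_e arc_slack (src e \in Z) (tgt e \in Z) (lo e) (up e).

(** Summation by parts: [chi] is a potential on the vertices, and each arc contributes its flow
    times the potential difference. *)
Lemma sum_excess y (chi : V -> int) :
  \sum_v chi v * excess y v = \sum_e y e * (chi (tgt e) - chi (src e)).
Proof.
under eq_bigr do rewrite big_distrr /=.
rewrite exchange_big; apply: eq_bigr => e _ /=.
have pick (u : V) : \sum_v chi v * (u == v)%:R = chi u.
  rewrite (bigD1 u) //= eqxx mulr1 big1 ?addr0 // => v.
  by rewrite eq_sym => /negbTE ->; rewrite mulr0.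
rewrite -[in RHS](pick (tgt e)) -[in RHS](pick (src e)) -sumrB mulr_sumr.
by apply: eq_bigr => v _; ring.
Qed.

Lemma sum_excess_set y Z :
  \sum_(v in Z) excess y v
  = \sum_e y e * ((tgt e \in Z)%:R - (src e \in Z)%:R).
Proof.
rewrite -(sum_excess y (fun v => (v \in Z)%:R)) [LHS]big_mkcond /=.
by apply: eq_bigr => v _; case: (v \in Z); rewrite ?mul1r ?mul0r.
Qed.

(** * Residual graph and augmenting paths *)

Definition residual y v w : bool :=
  [exists e, [&& src e == v, tgt e == w & ((y e)%:E < up e)%E]
          || [&& src e == w, tgt e == v & (lo e < (y e)%:E)%E]].

Definition shift_arc y e0 (d : int) e : int := y e + (if e == e0 then d else 0).

Lemma excess_shift_arc y e0 d v :
  excess (shift_arc y e0 d) v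
  = excess y v + d * ((tgt e0 == v)%:R - (src e0 == v)%:R).
Proof.
rewrite /excess /shift_arc; under eq_bigr do rewrite mulrDl.
rewrite big_split /=; congr (_ + _).
by rewrite (bigD1 e0) //= eqxx big1 ?addr0 // => e /negbTE ->; rewrite mul0r.
Qed.

(** An arc witnessing [residual y v w] has ends [v] and [w], so it cannot be [e0], one of whose ends
    is [a]. *)
Lemma residual_shift_arc y e0 d (a v w : V) : a \in [:: src e0; tgt e0] ->
  v != a -> w != a -> residual y v w -> residual (shift_arc y e0 d) v w.
Proof.
move=> ae0 va wa /existsP[e He]; apply/existsP; exists e; rewrite /shift_arc.
case: (e =P e0) => [ee0|_]; last by rewrite addr0.
move: ae0 He; rewrite {e}ee0 !inE => /orP[]/eqP ae0;
  by case/orP=> /and3P[/eqP sv /eqP tw _]; move: va wa;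
     rewrite ae0 -sv -tw eqxx.
Qed.

(** One unit fits because the bound is strict between integers: it is added on a forward arc and
    withdrawn from a backward one. *)
Lemma residual_step y v w : feasible y -> v != w -> residual y v w ->
  exists e d, [/\ feasible (shift_arc y e d), v \in [:: src e; tgt e]
    & forall u, excess (shift_arc y e d) u
                = excess y u + (u == w)%:R - (u == v)%:R].
Proof.
move=> fy vw /existsP[e /orP[]/and3P[/eqP se /eqP te lt_e]].
- exists e, 1; split=> [e'||u]; last 2 first.
  + by rewrite se !inE eqxx.
  + by rewrite excess_shift_arc se te mul1r addrA ![_ == u]eq_sym.
  rewrite /shift_arc; case: eqP => [->|_]; last by rewrite addr0.
  move: lt_e (fy e); case: (up e) (lo e) => [b||] [a||] //=;
    by rewrite ?lee_fin ?lte_fin ?leNye ?leey ?leeNy_eq ?andbF //; lia.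
- exists e, (-1); split=> [e'||u]; last 2 first.
  + by rewrite te !inE eqxx orbT.
  + by rewrite excess_shift_arc se te ![_ == u]eq_sym; ring.
  rewrite /shift_arc; case: eqP => [->|_]; last by rewrite addr0.
  move: lt_e (fy e); case: (up e) (lo e) => [b||] [a||] //=;
    by rewrite ?lee_fin ?lte_fin ?leNye ?leey ?leeNy_eq ?andbF //; lia.
Qed.

(** Push one unit along the first step, then recurse. The path is simple, so its remainder avoids
    [a], an end of the changed arc, and stays residual. *)
Lemma augment (p : seq V) y (a : V) :
    feasible y -> path (residual y) a p -> uniq (a :: p) ->
  exists2 y', feasible y' &
    forall v, excess y' v = excess y v + (v == last a p)%:R - (v == a)%:R.
Proof.
elim: p a y => [|b p IH] a y fy /=; first by exists y => // v; rewrite addrK.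
case/andP=> res_ab path_b /andP[a_notin uniq_b].
have ab : a != b by apply: contraNneq a_notin => ->; rewrite mem_head.
have [e [d [fy1 ae ex1]]] := residual_step fy ab res_ab.
have path1 : path (residual (shift_arc y e d)) b p.
  apply: (@sub_in_path _ (predC1 a)) path_b => [v w /= va wa|].
    exact: residual_shift_arc ae va wa.
  by apply/allP => v vbp; apply: contraNneq a_notin => <-.
have [y' fy' ex'] := IH _ _ fy1 path1 uniq_b.
by exists y' => // v; rewrite ex' ex1; ring.
Qed.

(** Both terms of the slack are then actual flows, and their difference is the net outflow. *)
Lemma cut_slack_saturated y Z :
    (forall e, src e \in Z -> tgt e \notin Z -> up e = (y e)%:E) ->
    (forall e, src e \notin Z -> tgt e \in Z -> lo e = (y e)%:E) ->
  cut_slack Z = (- \sum_(v in Z) excess y v)%:E.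
Proof.
move=> up_e lo_e; rewrite sum_excess_set -sumrN -sumEFin; apply: eq_bigr => e _.
rewrite /arc_slack; have := up_e e; have := lo_e e.
case: (src e \in Z); case: (tgt e \in Z) => /= lo_y up_y;
  rewrite ?subrr ?mulr0 ?oppr0 //.
- by rewrite up_y // sub0r mulrN1 opprK.
- by rewrite lo_y // subr0 mulr1.
Qed.

Hypotheses (lo_fin : forall e, lo e != +oo%E) (up_fin : forall e, up e != -oo%E).
Hypothesis lo_le_up : forall e, (lo e <= up e)%E.

Lemma feasible_exists : exists y, feasible y.
Proof.
(* A finite bound is itself an admissible value; an arc unbounded on both sides gets 0. *)
exists (fun e => match lo e, up e with
  | EFin a, _ => a | _, EFin b => b | _, _ => 0 end) => e.
move: (lo_fin e) (up_fin e) (lo_le_up e).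
by case: (lo e) (up e) => [a||] [b||] //=; rewrite ?lexx ?leNye ?leey.
Qed.

(** Induction on a bound [k] for the total absolute excess. Excesses sum to 0, so an imbalance
    yields a vertex [a] of positive excess. Either a vertex of negative excess is reachable from
    [a], and augmenting lowers the total, or the reachable set is a cut of negative slack. *)
Lemma hoffman_descent : (forall Z, (0 <= cut_slack Z)%E) ->
  forall k y, feasible y -> (\sum_v `|excess y v| <= k)%N ->
  exists2 y', feasible y' & forall v, excess y' v = 0.
Proof.
move=> slack_ge0; elim=> [|k IH] y fy le_k.
  exists y => // v; apply/eqP; rewrite -absz_eq0 -leqn0 (leq_trans _ le_k) //.
  by rewrite (bigD1 v) //= leq_addr.
have [/forallP ex0|] := boolP [forall v, excess y v == 0].
  by exists y => // v; apply/eqP.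
rewrite negb_forall => /existsP[v0 v0_neq0].
have sum0 : \sum_v excess y v = 0.
  have := sum_excess y (fun=> 1); under eq_bigr do rewrite mul1r.
  by move=> ->; rewrite big1 // => e _; rewrite subrr mulr0.
have [a a_gt0] : exists a, 0 < excess y a.
  apply/existsP; rewrite -[X in is_true X]negbK negb_exists; apply/negP=> /forallP le0.
  have /eqP := sum0; rewrite -oppr_eq0 -sumrN psumr_eq0 => [/allP/(_ v0)|v _].
    by rewrite mem_index_enum oppr_eq0 (negbTE v0_neq0) => /(_ isT).
  by rewrite oppr_ge0 leNgt.
pose Z := [set v | connect (residual y) a v].
have [/existsP[b0 /andP[]]|] := boolP [exists b in Z, excess y b < 0].
  rewrite inE => /connectP[p0 path0 ->]; case: (shortenP path0) => p pathp uniqp _.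
  set b := last a p => b_lt0.
  have ab : a != b by apply: contraTneq a_gt0 => ->; rewrite -leNgt ltW.
  have [y' fy' ex'] := augment fy pathp uniqp.
  apply: (IH y') => //; rewrite -ltnS; apply: leq_trans le_k.
  (* The positive excess at [a] loses one unit, a strict decrease; the negative one at [b] gains a
     unit, which cannot raise its absolute value. *)
  rewrite (bigD1 a) //= [X in (_ < X)%N](bigD1 a) //= -addSn leq_add //.
    by rewrite ex' -/b (negbTE ab) eqxx; lia.
  apply: leq_sum => v va; rewrite ex' (negbTE va) -/b.
  by case: eqVneq => [->|_]; rewrite ?addr0 ?subr0; lia.
rewrite negb_exists => /forallP ge0.
have fyE e := andP (fy e).
(* No residual arc leaves the reachable set, so outgoing arcs are at their upper bound and incoming
   ones at their lower bound. *)
have stepZ v w : v \in Z -> w \notin Z -> ~ residual y v w.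
  rewrite !inE => cv /negP nw r_vw; apply: nw.
  exact: connect_trans cv (connect1 r_vw).
have := slack_ge0 Z; rewrite (@cut_slack_saturated y); first last.
- move=> e s_e t_e; apply/eqP; rewrite eq_le (proj1 (fyE e)) andTb leNgt.
  apply/negP => lt_e; apply: (stepZ _ _ t_e s_e).
  by apply/existsP; exists e; rewrite !eqxx lt_e orbT.
- move=> e s_e t_e; apply/eqP; rewrite eq_le (proj2 (fyE e)) andbT leNgt.
  apply/negP => lt_e; apply: (stepZ _ _ s_e t_e).
  by apply/existsP; exists e; rewrite !eqxx lt_e.
rewrite lee_fin oppr_ge0 leNgt (bigD1 a) /=; last by rewrite inE connect0.
rewrite ltr_pwDl // sumr_ge0 // => v /andP[vZ _].
by have := ge0 v; rewrite vZ /= -leNgt.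
Qed.

Theorem hoffman_circulation :
  (exists2 y, feasible y & forall v, excess y v = 0) <->
  (forall Z, (0 <= cut_slack Z)%E).
Proof.
split=> [[y fy ex0] Z|slack_ge0]; last first.
  have [y fy] := feasible_exists; exact: hoffman_descent slack_ge0 _ y fy (leqnn _).
(* Writing 0 as the net outflow of a circulation allows comparison with the slack arc by arc. *)
have -> : 0%E = (- \sum_(v in Z) excess y v)%:E by rewrite big1 ?oppr0.
rewrite sum_excess_set -sumrN -sumEFin; apply: lee_sum => e _.
rewrite /arc_slack; have /andP[lo_y up_y] := fy e.
case: (src e \in Z); case: (tgt e \in Z); rewrite ?subrr ?mulr0 ?oppr0 //.
- by rewrite sub0r mulrN1 opprK.
- by rewrite subr0 mulr1 EFinN leeN2.
Qed.

End Circulation.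

(** * Maximal segments *)

(** [y] lives on all naturals so that the position past the end can be tested; [a == 0] is a
    separate case because [0.-1] is 0. *)
Definition maxrun (y : pred nat) a b : bool :=
  [&& all y (index_iota a b.+1), (a == 0) || ~~ y a.-1 & ~~ y b.+1]%N.

Lemma maxrunP (y : pred nat) a b :
  reflect [/\ forall k, (a <= k <= b)%N -> y k, (a == 0%N) || ~~ y a.-1
            & ~~ y b.+1] (maxrun y a b).
Proof.
apply: (iffP and3P) => -[all_y start stop]; split=> //.
  by move=> k k_ab; apply: (allP all_y); rewrite mem_index_iota ltnS.
by apply/allP => k; rewrite mem_index_iota ltnS; apply: all_y.
Qed.

Lemma run_start (y : pred nat) b : y b ->
  exists2 a, (a <= b)%N &
    (forall k, (a <= k <= b)%N -> y k) /\ (a == 0%N) || ~~ y a.-1.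
Proof.
elim: b => [|b IH] yb.
  by exists 0%N => //; split=> // k; rewrite leqn0 => /eqP->.
have [/IH [a le_ab [run start]]|nyb] := boolP (y b); last first.
  by exists b.+1 => //; split=> // k; rewrite -eqn_leq => /eqP <-.
exists a; [by rewrite leqW|split=> // k /andP[ak]].
by rewrite leq_eqVlt => /orP[/eqP-> //|kb]; apply: run; rewrite ak.
Qed.

Lemma run_stop (N : nat) (y : pred nat) a :
    (forall k, y k -> (k < N)%N) -> y a ->
  exists2 b, (a <= b)%N & (forall k, (a <= k <= b)%N -> y k) /\ ~~ y b.+1.
Proof.
move=> yN; have [d] := ubnP (N - a); elim: d a => // d IH a lt_d ya.
have [ya1|nya1] := boolP (y a.+1); last first.
  by exists a => //; split=> // k; rewrite -eqn_leq => /eqP <-.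
have [|b lt_ab [run stop]] := IH a.+1 _ ya1; first by have := yN _ ya; lia.
exists b; [exact: ltnW|split=> // k /andP[]].
rewrite leq_eqVlt => /orP[/eqP<- //|ak kb]; by apply: run; rewrite ak.
Qed.

(** A maximal run is determined by either of its ends, so the [A] terms are collected by right end
    and the [B] terms by left end. *)
Lemma sum_maxrun (N : nat) (y : pred nat) (A B : 'I_N -> \bar int) :
    (forall k, y k -> (k < N)%N) ->
  (\sum_(j1 < N) \sum_(j2 < N | (j1 <= j2)%N && maxrun y j1 j2) (A j2 + B j1)
   = \sum_(j < N | y j && ~~ y j.+1) A j
     + \sum_(j < N | y j && ((j == 0%N :> nat) || ~~ y j.-1)) B j)%E.
Proof.
move=> yN.
under eq_bigr do rewrite big_split /=.
rewrite big_split /=; congr (_ + _)%E.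
  rewrite (exchange_big_dep xpredT) //= [RHS]big_mkcond; apply: eq_bigr => j2 _.
  case: ifP => [/andP[yj nyj]|no_end]; last first.
    rewrite big_pred0 // => j1; apply: contraFF no_end => /andP[le12 /maxrunP[run _ ->]].
    by rewrite andbT run // le12 leqnn.
  have [a le_a [run start]] := run_start yj.
  have lt_a : (a < N)%N by exact: leq_ltn_trans le_a (ltn_ord j2).
  rewrite (big_pred1 (Ordinal lt_a)) // => j1; apply/andP/eqP => [|->]; last first.
    by split=> //; apply/maxrunP.
  case=> le12 /maxrunP[run1 start1 _]; apply/val_inj => /=; apply/eqP.
  (* Of two distinct runs ending at [j2], the one starting later could be extended to the left. *)
  rewrite eqn_leq [X in X && _]leqNgt [X in _ && X]leqNgt.
  apply/andP; split; apply/negP => lt_aj.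
    move: start1; rewrite run ?orbF; lia.
  move: start; rewrite run1 ?orbF; lia.
rewrite [RHS]big_mkcond; apply: eq_bigr => j1 _.
case: ifP => [/andP[yj start]|no_start]; last first.
  rewrite big_pred0 // => j2; apply: contraFF no_start => /andP[le12 /maxrunP[run -> _]].
  by rewrite andbT run // le12 leqnn.
have [b le_b [run stop]] := run_stop yN yj.
have lt_b : (b < N)%N by apply/yN/run; rewrite le_b leqnn.
rewrite (big_pred1 (Ordinal lt_b)) // => j2; apply/andP/eqP => [|->]; last first.
  by split=> //; apply/maxrunP.
case=> le12 /maxrunP[run2 _ stop2]; apply/val_inj => /=; apply/eqP.
rewrite eqn_leq [X in X && _]leqNgt [X in _ && X]leqNgt.
apply/andP; split; apply/negP => lt_bj.
  move: stop; rewrite run2 //; lia.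
move: stop2; rewrite run //; lia.
Qed.

(** A start at [j > 0] is recharged to position [j - 1], where the line is about to enter a run; a
    start at 0 contributes 0 by convention. *)
Lemma sum_starts (N : nat) (y : pred nat) (B : 'I_N -> \bar int) :
    (forall k, y k -> (k < N)%N) ->
  (\sum_(j < N | y j && ((j == 0%N :> nat) || ~~ y j.-1))
      - (if j == 0%N :> nat then 0 else B (ord_pred j))
   = \sum_(j < N | ~~ y j && y j.+1) - B j)%E.
Proof.
case: N B => [|N] B yN; first by rewrite !big_ord0.
rewrite big_mkcond big_ord_recl /= oppr0 if_same [LHS]add0e.
rewrite [RHS]big_mkcond big_ord_recr /=.
(* The last position precedes no start, which makes both sums the same length. *)
have -> : y N.+1 = false by apply/negP => /yN; rewrite ltnn.
rewrite andbF adde0; apply: eq_bigr => j _ /=; rewrite /bump /= add1n andbC.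
by case: ifP => // _; congr (- B _)%E; apply/val_inj => /=;
  rewrite add0n modnDr modn_small // ltnS ltnW.
Qed.

(** * Maximal segments on a family of lines, covering rows and columns alike *)

Section Lines.
Variables (T L : finType) (N : nat) (ln : L -> 'I_N -> T).
Hypothesis ln_inj : forall l j l' j', ln l j = ln l' j' -> l = l' /\ j = j'.
Implicit Types (l : L) (j : 'I_N) (X Y Z : {set T}).

Definition lseg l (j1 j2 : 'I_N) : {set T} := [set ln l j | j : 'I_N & (j1 <= j <= j2)%N].
Definition is_lseg Z : bool :=
  [exists l, exists j1 : 'I_N, exists j2 : 'I_N, (j1 <= j2)%N && (Z == lseg l j1 j2)].

(** Indexed by naturals and false from [N] on, so the successor of a last cell counts as outside
    [X]. *)
Definition on_line X l (k : nat) : bool :=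
  [exists j : 'I_N, (j == k :> nat) && (ln l j \in X)].

Lemma on_line_lt X l k : on_line X l k -> (k < N)%N.
Proof. by case/existsP=> j /andP[/eqP<-]. Qed.

Lemma on_line_ord X l j : on_line X l j = (ln l j \in X).
Proof.
apply/existsP/idP => [[j' /andP[/eqP /val_inj -> //]]|Xj].
by exists j; rewrite eqxx.
Qed.

Lemma mem_lseg l j l' (j1 j2 : 'I_N) :
  (ln l j \in lseg l' j1 j2) = (l == l') && (j1 <= j <= j2)%N.
Proof.
apply/imsetP/andP => [[j' + /ln_inj[-> ->]]|[/eqP-> j12]]; first by rewrite inE.
by exists j; rewrite ?inE.
Qed.

Lemma lseg_subP l (j1 j2 : 'I_N) X :
  reflect (forall j, (j1 <= j <= j2)%N -> ln l j \in X) (lseg l j1 j2 \subset X).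
Proof.
apply: (iffP subsetP) => [sub j j12|sub s /imsetP[j + ->]].
  by apply: sub; rewrite mem_lseg eqxx.
by rewrite inE; apply: sub.
Qed.

(** A cell of [X] adjacent to an end would extend the segment; conversely a strictly larger segment
    contains such a cell. *)
Lemma maxset_lseg X l (j1 j2 : 'I_N) : (j1 <= j2)%N ->
  maxset (fun Y => is_lseg Y && (Y \subset X)) (lseg l j1 j2)
  = maxrun (on_line X l) j1 j2.
Proof.
move=> le12; apply/maxsetP/maxrunP => [[/andP[_ /lseg_subP sub] maxi]|[run start stop]].
  have seg (a b : 'I_N) : (a <= b)%N -> is_lseg (lseg l a b).
    by move=> le_ab; apply/existsP; exists l; apply/existsP; exists a;
      apply/existsP; exists b; rewrite le_ab eqxx.
  split.
  - move=> k k12; have kN : (k < N)%N by case/andP: k12 => _ /leq_ltn_trans; apply.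
    by rewrite -[k]/(nat_of_ord (Ordinal kN)) on_line_ord; apply: sub.
  - have [//|j1_gt0 /=] := posnP j1; apply/negP => /existsP[a /andP[/eqP aE Xa]].
    (* Here [a] is the cell just before [j1], and adjoining it contradicts maximality. *)
    have /setP/(_ (ln l a)) : lseg l a j2 = lseg l j1 j2.
      apply: maxi; [rewrite seg ?andTb; last lia|].
        apply/lseg_subP => j; case: (j =P a) => [-> //|/eqP neq j12]; apply: sub.
        by move: neq; rewrite -val_eqE /=; lia.
      by apply/lseg_subP => j j12; rewrite mem_lseg eqxx; lia.
    by rewrite !mem_lseg eqxx; lia.
  - apply/negP => /existsP[a /andP[/eqP aE Xa]].
    have /setP/(_ (ln l a)) : lseg l j1 a = lseg l j1 j2.
      apply: maxi; [rewrite seg ?andTb; last lia|].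
        apply/lseg_subP => j; case: (j =P a) => [-> //|/eqP neq j12]; apply: sub.
        by move: neq; rewrite -val_eqE /=; lia.
      by apply/lseg_subP => j j12; rewrite mem_lseg eqxx; lia.
    by rewrite !mem_lseg eqxx; lia.
split.
  apply/andP; split; last by apply/lseg_subP => j j12; rewrite -on_line_ord run.
  by apply/existsP; exists l; apply/existsP; exists j1;
      apply/existsP; exists j2; rewrite le12 eqxx.
move=> Y /andP[/existsP[l' /existsP[a /existsP[b /andP[le_ab /eqP->]]]]].
move=> /lseg_subP subX /lseg_subP sub.
(* Both end cells lie in the larger segment, so it is on the same line and its ends enclose
   theirs. *)
have := sub j1; rewrite mem_lseg leqnn le12 => /(_ isT)/andP[/eqP ll' a_j1].
have := sub j2; rewrite mem_lseg leqnn le12 => /(_ isT)/andP[_ j2_b].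
rewrite -{l'}ll' in subX sub *.
have run_ab k : (a <= k <= b)%N -> on_line X l k.
  move=> k12; have kN : (k < N)%N by case/andP: k12 => _ /leq_ltn_trans; apply.
  by rewrite -[k]/(nat_of_ord (Ordinal kN)) on_line_ord; apply: subX.
have -> : a = j1.
  apply/val_inj/eqP => /=; apply/contraTT: start => neq.
  by rewrite run_ab; lia.
have -> // : b = j2.
apply/val_inj/eqP => /=; apply/contraNT: stop => neq.
by rewrite run_ab; lia.
Qed.

(** From segments to cells: the upper bound is paid where the line leaves [X], and minus the lower
    bound where it enters [X]. *)
Lemma sum_lines (Phi Gam : L -> 'I_N -> \bar int) X :
  (\sum_l \sum_(j1 < N)
     \sum_(j2 < N | (j1 <= j2)%N
                    && maxset (fun Y => is_lseg Y && (Y \subset X)) (lseg l j1 j2))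
       (Gam l j2 - (if j1 == 0%N :> nat then 0 else Phi l (ord_pred j1)))
   = \sum_l \sum_(j < N)
       arc_slack (ln l j \in X) (on_line X l j.+1) (Phi l j) (Gam l j))%E.
Proof.
apply: eq_bigr => l _.
have yN := @on_line_lt X l.
under eq_bigr => j1 _.
  under eq_bigl => j2.
    rewrite (_ : _ && _ = (j1 <= j2)%N && maxrun (on_line X l) j1 j2); last first.
      by case: (leqP j1 j2) => //= le12; rewrite maxset_lseg.
    over.
  over.
rewrite (sum_maxrun _ (fun j => - (if j == 0%N :> nat then 0 else Phi l (ord_pred j)))%E yN).
rewrite sum_starts // [X in (X + _)%E]big_mkcond [X in (_ + X)%E]big_mkcond -big_split.
apply: eq_bigr => j _ /=; rewrite on_line_ord /arc_slack.
by case: (ln l j \in X); case: (on_line X l j.+1); rewrite /= ?adde0 ?add0e.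
Qed.

End Lines.

(** * The prefix-sum network *)

Lemma telescope_from (N a : nat) (c : nat -> int) : (a <= N)%N ->
  \sum_(j < N | (a <= j)%N) (c j - c j.+1) = c a - c N.
Proof.
elim: N => [|N IH]; first by rewrite leqn0 => /eqP->; rewrite big_ord0 subrr.
rewrite leq_eqVlt big_mkcond big_ord_recr -big_mkcond /= => /orP[/eqP->|lt_aN].
  rewrite ltnn addr0 subrr big_pred0 // => j.
  by apply/negbTE; rewrite -ltnNge ltnS ltnW.
by rewrite -ltnS lt_aN IH //; ring.
Qed.

(** Abel summation. In the application [c] is a node potential along a row or column, and [c N] is
    its value at the source or sink. *)
Lemma sum_prefix_telescope (N : nat) (x : 'I_N -> int) (c : nat -> int) :
  \sum_(j < N) (\sum_(j' < N | (j' <= j)%N) x j') * (c j - c j.+1)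
  = \sum_(j < N) x j * (c j - c N).
Proof.
under eq_bigr do rewrite mulr_suml.
rewrite (exchange_big_dep xpredT) //=; apply: eq_bigr => j _.
by rewrite -mulr_sumr telescope_from // ltnW.
Qed.

Section Boundary.
Variables m n : nat.
Notation S := ('I_m * 'I_n)%type.
Implicit Types (X : {set S}) (Phi Gam : 'M[\bar int]_(m, n)).

Definition hline (i : 'I_m) (j : 'I_n) : S := (i, j).
Definition vline (j : 'I_n) (i : 'I_m) : S := (i, j).

Lemma hline_inj i j i' j' : hline i j = hline i' j' -> i = i' /\ j = j'.
Proof. by case. Qed.

Lemma vline_inj j i j' i' : vline j i = vline j' i' -> j = j' /\ i = i'.
Proof. by case. Qed.

Lemma hseg_lseg i j1 j2 : hseg i j1 j2 = lseg hline i j1 j2.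
Proof.
apply/setP => -[i' j']; rewrite -/(hline i' j') (mem_lseg hline_inj) inE.
by rewrite eq_sym.
Qed.

Lemma vseg_lseg j i1 i2 : vseg j i1 i2 = lseg vline j i1 i2.
Proof.
apply/setP => -[i' j']; rewrite -/(vline j' i') (mem_lseg vline_inj) inE.
by rewrite eq_sym.
Qed.

Lemma Iho_lseg X i j1 j2 : (hseg i j1 j2 \in Iho X)
  = maxset (fun Y => is_lseg hline Y && (Y \subset X)) (lseg hline i j1 j2).
Proof.
rewrite inE hseg_lseg; apply: maxset_eq => Y; congr (_ && _).
apply: eq_existsb => i'; apply: eq_existsb => a; apply: eq_existsb => b.
by rewrite hseg_lseg.
Qed.

Lemma Ive_lseg X j i1 i2 : (vseg j i1 i2 \in Ive X)
  = maxset (fun Y => is_lseg vline Y && (Y \subset X)) (lseg vline j i1 i2).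
Proof.
rewrite inE vseg_lseg; apply: maxset_eq => Y; congr (_ && _).
apply: eq_existsb => j'; apply: eq_existsb => a; apply: eq_existsb => b.
by rewrite vseg_lseg.
Qed.

(** This is the slack of the row arcs taken in the direction opposite to that of the network; for
    columns the directions agree. *)
Lemma bstar1E Phi Gam X :
  (bstar1 Phi Gam X = \sum_(s : S)
     arc_slack (s \in X) (on_line hline X s.1 s.2.+1) (Phi s.1 s.2) (Gam s.1 s.2))%E.
Proof.
rewrite /bstar1.
under eq_bigr => i _ do under eq_bigr => j1 _ do
  under eq_bigl => j2 do rewrite Iho_lseg.
rewrite (sum_lines hline_inj (fun i j => Phi i j) (fun i j => Gam i j)).
by rewrite pair_bigA; apply: eq_bigr => -[].
Qed.

Lemma bstar2E Phi Gam X :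
  (bstar2 Phi Gam X = \sum_(s : S)
     arc_slack (s \in X) (on_line vline X s.2 s.1.+1) (Phi s.1 s.2) (Gam s.1 s.2))%E.
Proof.
rewrite /bstar2.
under eq_bigr => j _ do under eq_bigr => i1 _ do
  under eq_bigl => i2 do rewrite Ive_lseg.
rewrite (sum_lines vline_inj (fun j i => Phi i j) (fun j i => Gam i j)).
by rewrite exchange_big pair_bigA; apply: eq_bigr => -[].
Qed.

Lemma pstar1E Phi Gam X : pstar1 Phi Gam X = bstar1 Gam Phi X.
Proof. by []. Qed.

Lemma pstar2E Phi Gam X : pstar2 Phi Gam X = bstar2 Gam Phi X.
Proof. by []. Qed.

End Boundary.

Section Network.
Variables m n : nat.
Notation S := ('I_m * 'I_n)%type.
Implicit Types (X : {set S}) (x : 'M[int]_(m, n)) (i : 'I_m) (j : 'I_n).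

(* The two copies of S are the nodes r and c; inr false is s, inr true is t. *)
Definition node := (S + S + bool)%type.
(* In order: row prefix sums, column prefix sums, entries, total sum. *)
Definition arc := ((S + S) + (S + unit))%type.

(** An index past the last column denotes the source, so the last prefix arc of a row is not a
    special case; [col_node] does the same with the sink. *)
Definition row_node i (k : nat) : node :=
  if insub k is Some j then inl (inl (i, j)) else inr false.
Definition col_node j (k : nat) : node :=
  if insub k is Some i then inl (inr (i, j)) else inr true.

Definition arc_src (e : arc) : node :=
  match e with
  | inl (inl s) => row_node s.1 s.2.+1
  | inl (inr s) => inl (inr s)
  | inr (inl s) => inl (inl s)
  | inr (inr _) => inr true
  end.

Definition arc_tgt (e : arc) : node :=
  match e with
  | inl (inl s) => inl (inl s)
  | inl (inr s) => col_node s.2 s.1.+1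
  | inr (inl s) => inl (inr s)
  | inr (inr _) => inr false
  end.

Definition arc_val (A : Type) (M1 M2 h : S -> A) (a : A) (e : arc) : A :=
  match e with
  | inl (inl s) => M1 s
  | inl (inr s) => M2 s
  | inr (inl s) => h s
  | inr (inr _) => a
  end.

(* X1 and X2 are complemented when s, resp. t, belongs to the cut, which matches
   the sets over which the theorem quantifies. *)
Definition cutset (bs bt : bool) X1 X2 : {set node} :=
  [set v | match v : node with
           | inl (inl s) => (s \in X1) (+) bs
           | inl (inr s) => (s \in X2) (+) bt
           | inr b => if b then bt else bs
           end].

Lemma row_nodeE i j : row_node i j = inl (inl (i, j)).
Proof. by rewrite /row_node valK. Qed.

Lemma row_node_last i : row_node i n = inr false.
Proof. by rewrite /row_node insubN // ltnn. Qed.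

Lemma col_nodeE j i : col_node j i = inl (inr (i, j)).
Proof. by rewrite /col_node valK. Qed.

Lemma col_node_last j : col_node j m = inr true.
Proof. by rewrite /col_node insubN // ltnn. Qed.

(** Valid past the last column too: [on_line] is false there, leaving [bs], the membership of the
    source. *)
Lemma row_node_cutset bs bt X1 X2 i k :
  (row_node i k \in cutset bs bt X1 X2) = on_line (@hline m n) X1 i k (+) bs.
Proof.
rewrite /row_node; case: insubP => [j _ <-|nk]; first by rewrite inE on_line_ord.
rewrite inE; suff -> : on_line (@hline m n) X1 i k = false by [].
by apply: contraNF nk; apply: on_line_lt.
Qed.

Lemma col_node_cutset bs bt X1 X2 j k :
  (col_node j k \in cutset bs bt X1 X2) = on_line (@vline m n) X2 j k (+) bt.
Proof.
rewrite /col_node; case: insubP => [i _ <-|nk]; first by rewrite inE on_line_ord.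
rewrite inE; suff -> : on_line (@vline m n) X2 j k = false by [].
by apply: contraNF nk; apply: on_line_lt.
Qed.

Lemma cutset_surj (Z : {set node}) :
  exists X1 X2, Z = cutset (inr false \in Z) (inr true \in Z) X1 X2.
Proof.
exists [set s | (inl (inl s) \in Z) (+) (inr false \in Z)].
exists [set s | (inl (inr s) \in Z) (+) (inr true \in Z)].
by apply/setP => -[[s|s]|[]]; rewrite !inE // -addbA addbb addbF.
Qed.

Lemma sum_arc (A : nmodType) (F : arc -> A) :
  \sum_e F e = (\sum_s F (inl (inl s)) + \sum_s F (inl (inr s)))
               + (\sum_s F (inr (inl s)) + F (inr (inr tt))).
Proof.
rewrite big_sumType /= !big_sumType /=; congr (_ + (_ + _)).
by rewrite (big_pred1 tt) // => -[].
Qed.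

Lemma sum_prefix1 (A : nmodType) (F : S -> A) i j :
  \sum_(s in prefix1 i j) F s = \sum_(j' < n | (j' <= j)%N) F (i, j').
Proof.
transitivity (\sum_(i' | i' == i) \sum_(j' < n | (j' <= j)%N) F (i', j')).
  by rewrite pair_big /=; apply: eq_big => [s|[]]; rewrite ?inE.
exact: big_pred1_eq.
Qed.

Lemma sum_prefix2 (A : nmodType) (F : S -> A) i j :
  \sum_(s in prefix2 i j) F s = \sum_(i' < m | (i' <= i)%N) F (i', j).
Proof.
transitivity (\sum_(j' | j' == j) \sum_(i' < m | (i' <= i)%N) F (i', j')).
  rewrite exchange_big pair_big /=; apply: eq_big => [s|[]//].
  by rewrite inE andbC.
exact: big_pred1_eq.
Qed.

(** * The circulation of a matrix *)

Definition flow_of x : arc -> int :=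
  arc_val (fun s => \sum_(s' in prefix1 s.1 s.2) x s'.1 s'.2)
          (fun s => \sum_(s' in prefix2 s.1 s.2) x s'.1 s'.2)
          (fun s => x s.1 s.2) (\sum_s x s.1 s.2).

(** With [chi] the indicator of [v], Abel summation turns row and column arcs into entries times
    chi(r) - chi(s) and chi(t) - chi(c). The entry arcs add chi(c) - chi(r) and the total arc chi(s)
    - chi(t), so all cancels cell by cell. *)
Lemma excess_flow_of x v : excess arc_src arc_tgt (flow_of x) v = 0.
Proof.
rewrite /excess; set chi := fun u => (u == v)%:R : int.
rewrite -[LHS]/(\sum_e flow_of x e * (chi (arc_tgt e) - chi (arc_src e))) sum_arc /=.
have -> : \sum_(s : S) (\sum_(s' in prefix1 s.1 s.2) x s'.1 s'.2)
             * (chi (inl (inl s)) - chi (row_node s.1 s.2.+1))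
          = \sum_(s : S) x s.1 s.2 * (chi (inl (inl s)) - chi (inr false)).
  rewrite -(pair_bigA _ (fun i j => x i j * (chi (inl (inl (i, j))) - chi (inr false)))) /=.
  rewrite -(pair_bigA _ (fun i j => (\sum_(s' in prefix1 i j) x s'.1 s'.2)
             * (chi (inl (inl (i, j))) - chi (row_node i j.+1)))) /=.
  apply: eq_bigr => i _.
  rewrite -(row_node_last i).
  under eq_bigr => j _ do rewrite sum_prefix1 -row_nodeE.
  under [RHS]eq_bigr => j _ do rewrite -row_nodeE.
  exact: sum_prefix_telescope (x i) (fun k => chi (row_node i k)).
have -> : \sum_(s : S) (\sum_(s' in prefix2 s.1 s.2) x s'.1 s'.2)
             * (chi (col_node s.2 s.1.+1) - chi (inl (inr s)))
          = - \sum_(s : S) x s.1 s.2 * (chi (inl (inr s)) - chi (inr true)).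
  rewrite -(pair_bigA _ (fun i j => x i j * (chi (inl (inr (i, j))) - chi (inr true)))) /=.
  rewrite -(pair_bigA _ (fun i j => (\sum_(s' in prefix2 i j) x s'.1 s'.2)
             * (chi (col_node j i.+1) - chi (inl (inr (i, j)))))) /=.
  rewrite exchange_big [in RHS]exchange_big -sumrN; apply: eq_bigr => j _ /=.
  rewrite -(col_node_last j).
  under [in RHS]eq_bigr => i _ do rewrite -col_nodeE.
  rewrite -(sum_prefix_telescope (fun i => x i j) (fun k => chi (col_node j k))).
  by rewrite -sumrN; apply: eq_bigr => i _; rewrite sum_prefix2 -col_nodeE; ring.
by rewrite mulr_suml -sumrN -!big_split big1 //= => s _; ring.
Qed.

Lemma on_prefix1 i j i' k :
  on_line (@hline m n) (prefix1 i j) i' k = (i' == i) && (k <= j)%N.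
Proof.
apply/existsP/andP => [[j' /andP[/eqP <-]]|[/eqP-> kj]].
  by rewrite inE => /andP.
exists (Ordinal (leq_ltn_trans kj (ltn_ord j))).
by rewrite inE /= !eqxx.
Qed.

Lemma on_prefix2 i j j' k :
  on_line (@vline m n) (prefix2 i j) j' k = (j' == j) && (k <= i)%N.
Proof.
apply/existsP/andP => [[i' /andP[/eqP <-]]|[/eqP-> ki]].
  by rewrite inE => /andP.
exists (Ordinal (leq_ltn_trans ki (ltn_ord i))).
by rewrite inE /= !eqxx.
Qed.

Lemma on_line0 (T L : finType) N (ln : L -> 'I_N -> T) l k :
  on_line ln set0 l k = false.
Proof. by apply/existsP => -[j]; rewrite inE andbF. Qed.

Lemma sum_indic (F : S -> int) X :
  \sum_s F s * (s \in X)%:R = \sum_(s in X) F s.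
Proof.
by rewrite [RHS]big_mkcond; apply: eq_bigr => s _; case: (s \in X);
  rewrite ?mulr1 ?mulr0.
Qed.

(** * The matrix of a circulation *)

Section Conservation.
Variable y : arc -> int.
Hypothesis y_circ : forall v, excess arc_src arc_tgt y v = 0.

Lemma cut_balance bs bt X1 X2 :
  \sum_e y e * ((arc_tgt e \in cutset bs bt X1 X2)%:R
                - (arc_src e \in cutset bs bt X1 X2)%:R) = 0.
Proof. by rewrite -sum_excess_set big1. Qed.

(** Cut around the row nodes of the prefix: only the row arc of [(i, j)] enters, and only the entry
    arcs of the prefix leave. *)
Lemma circ_prefix1 i j :
  \sum_(s in prefix1 i j) y (inr (inl s)) = y (inl (inl (i, j))).
Proof.
have := cut_balance false false (prefix1 i j) set0.
rewrite sum_arc /= (bigD1 (i, j)) //= big1 => [|[i' j'] neq]; last first.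
  rewrite row_node_cutset on_prefix1 !inE !addbF /=.
  move: neq; rewrite xpair_eqE -!val_eqE /=.
  case: (_ == _) => //=; last by rewrite subrr mulr0.
  by case: ltngtP => //= _ _; rewrite subrr mulr0.
rewrite [X in _ + X + _]big1 => [|s _]; last first.
  by rewrite col_node_cutset on_line0 !inE subrr mulr0.
rewrite row_node_cutset on_prefix1 !inE !addbF ltnn eqxx leqnn !andbF /=.
rewrite subr0 mulr1 subrr mulr0 !addr0.
under eq_bigr do rewrite !inE /= !addbF sub0r mulrN.
rewrite sumrN => /eqP; rewrite subr_eq0 => /eqP ->.
by rewrite -sum_indic; apply: eq_bigr => s _; rewrite inE.
Qed.

(** Cut around the column nodes of the prefix: the entry arcs enter, and only the column arc of
    [(i, j)] leaves. *)
Lemma circ_prefix2 i j :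
  \sum_(s in prefix2 i j) y (inr (inl s)) = y (inl (inr (i, j))).
Proof.
have := cut_balance false false set0 (prefix2 i j).
rewrite sum_arc /= big1 => [|s _]; last first.
  by rewrite row_node_cutset on_line0 !inE subrr mulr0.
rewrite (bigD1 (i, j)) //= big1 => [|[i' j'] neq]; last first.
  rewrite col_node_cutset on_prefix2 !inE !addbF /=.
  move: neq; rewrite xpair_eqE -!val_eqE /= andbC.
  case: (_ == _) => //=; last by rewrite subrr mulr0.
  by case: ltngtP => //= _ _; rewrite subrr mulr0.
rewrite col_node_cutset on_prefix2 !inE !addbF ltnn eqxx leqnn !andbF /=.
rewrite sub0r mulrN1 subrr mulr0 !addr0 add0r.
under eq_bigr do rewrite !inE /= !addbF subr0.
rewrite addrC => /eqP; rewrite subr_eq0 => /eqP <-.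
by rewrite -sum_indic; apply: eq_bigr => s _; rewrite inE.
Qed.

(** Cut formed by the source and all row nodes: the total arc enters and the entry arcs leave. *)
Lemma circ_total : \sum_s y (inr (inl s)) = y (inr (inr tt)).
Proof.
have := cut_balance true false set0 set0.
rewrite sum_arc /= big1 => [|s _]; last first.
  by rewrite row_node_cutset on_line0 !inE subrr mulr0.
rewrite big1 => [|s _]; last first.
  by rewrite col_node_cutset on_line0 !inE subrr mulr0.
rewrite !inE subr0 mulr1 !add0r.
under eq_bigr do rewrite !inE /= sub0r mulrN1.
by rewrite sumrN addrC => /eqP; rewrite subr_eq0 => /eqP.
Qed.

End Conservation.

(** * Bounds on the arcs and the slack of a cut *)

Variables (Phi1 Gam1 Phi2 Gam2 : 'M[\bar int]_(m, n)).
Variables (f g : S -> \bar int) (alpha beta : \bar int).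

Definition arc_lo : arc -> \bar int :=
  arc_val (fun s => Phi1 s.1 s.2) (fun s => Phi2 s.1 s.2) f alpha.
Definition arc_up : arc -> \bar int :=
  arc_val (fun s => Gam1 s.1 s.2) (fun s => Gam2 s.1 s.2) g beta.

Lemma tilde_mxfun x X : tilde (mxfun x) X = (\sum_(s in X) x s.1 s.2)%:E.
Proof. by rewrite /tilde -sumEFin. Qed.

Lemma sum_setT (F : S -> int) : \sum_(s in [set: S]) F s = \sum_s F s.
Proof. by apply: eq_bigl => s; rewrite inE. Qed.

(** Entry arcs carry the matrix; conservation forces the other arcs to carry its prefix sums and
    total, so the bounds correspond arc by arc. *)
Lemma matrix_circulation :
  (exists x : 'M[int]_(m, n),
     [/\ prefix_bounded Phi1 Gam1 Phi2 Gam2 x,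
         forall s, (f s <= mxfun x s <= g s)%E
       & (alpha <= tilde (mxfun x) [set: S] <= beta)%E])
  <-> (exists2 y, feasible arc_lo arc_up y
                & forall v, excess arc_src arc_tgt y v = 0).
Proof.
split=> [[x [bnd fxg tot]]|[y fy y_circ]].
  exists (flow_of x); last exact: excess_flow_of.
  case=> [[[i j]|[i j]]|[s|[]]] /=.
  - by have [+ _] := bnd i j; rewrite tilde_mxfun.
  - by have [_ +] := bnd i j; rewrite tilde_mxfun.
  - exact: fxg.
  - by move: tot; rewrite tilde_mxfun sum_setT.
exists (\matrix_(i, j) y (inr (inl (i, j)))).
have sumE X : tilde (mxfun (\matrix_(i, j) y (inr (inl (i, j))))) X
              = (\sum_(s in X) y (inr (inl s)))%:E.
  by rewrite tilde_mxfun; congr (_%:E); apply: eq_bigr => -[i j] _; rewrite mxE.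
split=> [i j|[i j]|].
- rewrite !sumE circ_prefix1 // circ_prefix2 //.
  by split; [exact: (fy (inl (inl (i, j)))) | exact: (fy (inl (inr (i, j))))].
- by rewrite /mxfun mxE; exact: (fy (inr (inl (i, j)))).
- rewrite sumE sum_setT circ_total //; exact: (fy (inr (inr tt))).
Qed.

Hypothesis Phi1_fin : forall i j, Phi1 i j != +oo%E.
Hypothesis Gam1_fin : forall i j, Gam1 i j != -oo%E.
Hypothesis Phi2_fin : forall i j, Phi2 i j != +oo%E.
Hypothesis Gam2_fin : forall i j, Gam2 i j != -oo%E.
Hypotheses (f_fin : forall s, f s != +oo%E) (g_fin : forall s, g s != -oo%E).

Lemma pstar1_slack X :
  (- pstar1 Phi1 Gam1 X = \sum_(s : S) arc_slack (on_line (@hline m n) X s.1 s.2.+1)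
     (s \in X) (Phi1 s.1 s.2) (Gam1 s.1 s.2))%E.
Proof.
rewrite pstar1E bstar1E -sum_oppe; last by move=> s; rewrite arc_slack_neqy.
by apply: eq_bigr => s _; rewrite oppe_arc_slack.
Qed.

Lemma pstar2_slack X :
  (- pstar2 Phi2 Gam2 X = \sum_(s : S) arc_slack (on_line (@vline m n) X s.2 s.1.+1)
     (s \in X) (Phi2 s.1 s.2) (Gam2 s.1 s.2))%E.
Proof.
rewrite pstar2E bstar2E -sum_oppe; last by move=> s; rewrite arc_slack_neqy.
by apply: eq_bigr => s _; rewrite oppe_arc_slack.
Qed.

Lemma cell_slack (A B : {set S}) :
  (\sum_s arc_slack (s \in A) (s \in B) (f s) (g s)
   = tilde g (A :\: B) - tilde f (B :\: A))%E.
Proof.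
rewrite /tilde -sum_oppe // [X in _ = (X + _)%E]big_mkcond.
rewrite [X in _ = (_ + X)%E]big_mkcond -big_split /=.
apply: eq_bigr => s _; rewrite !inE /arc_slack.
by case: (s \in A); case: (s \in B); rewrite /= ?adde0 ?add0e.
Qed.

(** [flip] recovers the actual cut on the cells. If s is in the cut, both ends of each row arc are
    complemented, which reverses the arc ([arc_slackC]) and replaces [- pstar1] by [bstar1]; t acts
    on columns, replacing [bstar2] by [- pstar2]. *)
Lemma cut_slackE bs bt X1 X2 (flip := fun b X => if b then ~: X else X) :
  (cut_slack arc_src arc_tgt arc_lo arc_up (cutset bs bt X1 X2)
   = ((if bs then bstar1 Phi1 Gam1 X1 else - pstar1 Phi1 Gam1 X1)
      + (if bt then - pstar2 Phi2 Gam2 X2 else bstar2 Phi2 Gam2 X2))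
     + ((tilde g (flip bs X1 :\: flip bt X2) - tilde f (flip bt X2 :\: flip bs X1))
        + arc_slack bt bs alpha beta))%E.
Proof.
rewrite /cut_slack sum_arc /= -cell_slack; congr (_ + _ + (_ + _))%E.
- rewrite bstar1E pstar1_slack.
  case: bs; apply: eq_bigr => s _; rewrite row_node_cutset inE ?addbT ?addbF //.
  exact: arc_slackC.
- rewrite bstar2E pstar2_slack.
  case: bt; apply: eq_bigr => s _; rewrite col_node_cutset inE ?addbT ?addbF //.
  exact: arc_slackC.
- by apply: eq_bigr => s _; rewrite !inE; case: bs bt => [] [];
    rewrite /flip ?inE ?addbT ?addbF.
- by rewrite !inE.
Qed.

Lemma pstar1_neqy X : pstar1 Phi1 Gam1 X != +oo%E.
Proof.
by rewrite pstar1E bstar1E sum_neqy // => s; rewrite arc_slack_neqy.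
Qed.

Lemma pstar2_neqy X : pstar2 Phi2 Gam2 X != +oo%E.
Proof.
by rewrite pstar2E bstar2E sum_neqy // => s; rewrite arc_slack_neqy.
Qed.

Lemma bstar1_neqNy X : bstar1 Phi1 Gam1 X != -oo%E.
Proof. by rewrite bstar1E sum_neqNy // => s; rewrite arc_slack_neqNy. Qed.

Lemma bstar2_neqNy X : bstar2 Phi2 Gam2 X != -oo%E.
Proof. by rewrite bstar2E sum_neqNy // => s; rewrite arc_slack_neqNy. Qed.

Hypotheses (alpha_fin : alpha != +oo%E) (beta_fin : beta != -oo%E).

(** The four inequalities come from cuts containing, in order, neither s nor t, both, only s, only
    t. The total arc runs from t to s, so it crosses only in the last two cases, contributing
    [- alpha] and [beta]. *)
Lemma cut_slack_conditions X1 X2 :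
  (forall bs bt,
     (0 <= cut_slack arc_src arc_tgt arc_lo arc_up (cutset bs bt X1 X2))%E) <->
  [/\ pstar1 Phi1 Gam1 X1 + tilde f (X2 :\: X1)
        <= bstar2 Phi2 Gam2 X2 + tilde g (X1 :\: X2),
      pstar2 Phi2 Gam2 X2 + tilde f (X1 :\: X2)
        <= bstar1 Phi1 Gam1 X1 + tilde g (X2 :\: X1),
      alpha <= bstar1 Phi1 Gam1 X1 + bstar2 Phi2 Gam2 X2
                 + tilde g (~: X1 :&: ~: X2) - tilde f (X1 :&: X2)
    & pstar1 Phi1 Gam1 X1 + pstar2 Phi2 Gam2 X2
        + tilde f (~: X1 :&: ~: X2) - tilde g (X1 :&: X2) <= beta]%E.
Proof.
have f_neqy X : tilde f X != +oo%E by exact: sum_neqy.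
have g_neqNy X : tilde g X != -oo%E by exact: sum_neqNy.
have := (pstar1_neqy X1, pstar2_neqy X2, bstar1_neqNy X1, bstar2_neqNy X2).
move=> [[[p1_fin p2_fin] b1_fin] b2_fin].
have ff : (0 <= cut_slack arc_src arc_tgt arc_lo arc_up (cutset false false X1 X2))%E
  = (pstar1 Phi1 Gam1 X1 + tilde f (X2 :\: X1)
       <= bstar2 Phi2 Gam2 X2 + tilde g (X1 :\: X2))%E.
  by rewrite cut_slackE /arc_slack slack_ge0_eq.
have tt : (0 <= cut_slack arc_src arc_tgt arc_lo arc_up (cutset true true X1 X2))%E
  = (pstar2 Phi2 Gam2 X2 + tilde f (X1 :\: X2)
       <= bstar1 Phi1 Gam1 X1 + tilde g (X2 :\: X1))%E.
  rewrite cut_slackE /arc_slack addeC !setDE !setCK.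
  rewrite [~: X1 :&: X2]setIC [~: X2 :&: X1]setIC -!setDE addeC [X in (X + _)%E]addeC; exact: slack_ge0_eq.
have tf : (0 <= cut_slack arc_src arc_tgt arc_lo arc_up (cutset true false X1 X2))%E
  = (alpha <= bstar1 Phi1 Gam1 X1 + bstar2 Phi2 Gam2 X2
                 + tilde g (~: X1 :&: ~: X2) - tilde f (X1 :&: X2))%E.
  rewrite cut_slackE /arc_slack !setDE setCK [X2 :&: X1]setIC.
  exact: alpha_slack_eq.
have ft : (0 <= cut_slack arc_src arc_tgt arc_lo arc_up (cutset false true X1 X2))%E
  = (pstar1 Phi1 Gam1 X1 + pstar2 Phi2 Gam2 X2
        + tilde f (~: X1 :&: ~: X2) - tilde g (X1 :&: X2) <= beta)%E.
  rewrite cut_slackE /arc_slack !setDE setCK [~: X2 :&: _]setIC.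
  exact: beta_slack_eq.
split=> [slack_ge0|[c1 c2 c3 c4]]; first by rewrite -ff -tt -tf -ft.
by case=> [] []; rewrite ?tt ?tf ?ft ?ff.
Qed.

End Network.

Local Open Scope ereal_scope.

Theorem theorem5p6 (m n : nat) (m_gt0 : (0 < m)%N) (n_gt0 : (0 < n)%N)
    (Phi1 Gam1 Phi2 Gam2 : 'M[\bar int]_(m, n))
    (f g : 'I_m * 'I_n -> \bar int) (alpha beta : \bar int)
    (Phi1_fin : forall i j, Phi1 i j != +oo)
    (Gam1_fin : forall i j, Gam1 i j != -oo)
    (Phi2_fin : forall i j, Phi2 i j != +oo)
    (Gam2_fin : forall i j, Gam2 i j != -oo)
    (f_fin : forall s, f s != +oo) (g_fin : forall s, g s != -oo)
    (alpha_fin : alpha != +oo) (beta_fin : beta != -oo)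
    (Phi1_le : forall i j, Phi1 i j <= Gam1 i j)
    (Phi2_le : forall i j, Phi2 i j <= Gam2 i j)
    (f_le_g : forall s, f s <= g s) (alpha_le_beta : alpha <= beta) :
  (exists x : 'M[int]_(m, n),
     [/\ prefix_bounded Phi1 Gam1 Phi2 Gam2 x,
         forall s, f s <= mxfun x s <= g s
       & alpha <= tilde (mxfun x) [set: 'I_m * 'I_n] <= beta])
  <->
  (forall X1 X2 : {set 'I_m * 'I_n},
     [/\ pstar1 Phi1 Gam1 X1 + tilde f (X2 :\: X1)
           <= bstar2 Phi2 Gam2 X2 + tilde g (X1 :\: X2),
         pstar2 Phi2 Gam2 X2 + tilde f (X1 :\: X2)
           <= bstar1 Phi1 Gam1 X1 + tilde g (X2 :\: X1),
         alpha <= bstar1 Phi1 Gam1 X1 + bstar2 Phi2 Gam2 X2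
                    + tilde g (~: X1 :&: ~: X2) - tilde f (X1 :&: X2)
       & pstar1 Phi1 Gam1 X1 + pstar2 Phi2 Gam2 X2
           + tilde f (~: X1 :&: ~: X2) - tilde g (X1 :&: X2) <= beta]).
Proof.
apply: iff_trans (matrix_circulation _ _ _ _ _ _ _ _) _.
apply: iff_trans (hoffman_circulation _ _ _ _ _) _.
(* The bound hypotheses of Hoffman's theorem, checked for each kind of arc. *)
- by case=> [[[i j]|[i j]]|[s|[]]] /=.
- by case=> [[[i j]|[i j]]|[s|[]]] /=.
- by case=> [[[i j]|[i j]]|[s|[]]] /=.
split=> [slack_ge0 X1 X2|conds Z].
  by apply/cut_slack_conditions => // bs bt.
(* Every cut is a [cutset], so its slack is one of the four governed by the inequalities for [X1]
   and [X2]. *)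
have [X1 [X2 ->]] := cutset_surj Z.
exact: (proj2 (cut_slack_conditions _ _ _ _ _ _ _ _ X1 X2)).
Qed.
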